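(* Let $C_\phi$ be a composition operator on a directed graph with one circuit (as defined in the context) and suppose $C_\phi\in\boldsymbol B(L^2(\mu))$. Then the following are equivalent: (i) $C_\phi$ is analytic; (ii) the series $\sum_{i=1}^\eta\sum_{l=0}^\infty\mu(x_{i,\,l\kappa+r})$ is divergent for every $r\in\{1,\ldots,\kappa\}$.
   Context: Setting. $\mathbb N=\{1,2,\ldots\}$. Let $\kappa\in\mathbb N$, $\eta\in\mathbb N\cup\{\infty\}$, $J_{[1,\eta]}=\{i\in\mathbb N: i\le\eta\}$ (so $J_{[1,\infty]}=\mathbb N$), and let $X=\{x_1,\ldots,x_\kappa\}\cup\{x_{i,j}: i\in J_{[1,\eta]},\, j\in\mathbb N\}$, all the listed points being distinct. Let $\mathscr A$ be the $\sigma$-algebra of all subsets of $X$ and $\mu$ a positive measure on $\mathscr A$ with $\mu(x):=\mu(\{x\})\in(0,\infty)$ for all $x\in X$. Define $\phi\colon X\to X$ by $\phi(x_{i,j})=x_{i,j-1}$ for $j\ge2$, $\phi(x_{i,1})=x_\kappa$, $\phi(x_1)=x_\kappa$, and $\phi(x_i)=x_{i-1}$ for $2\le i\le\kappa$. The operator $C_\phi f=f\circ\phi$ in the complex space $L^2(\mu)=L^2(X,\mathscr A,\mu)$ is called a composition operator on a directed graph with one circuit. $C_\phi\in\boldsymbol B(L^2(\mu))$ means that $C_\phi$ is everywhere defined and bounded on $L^2(\mu)$. $C_\phi$ is analytic if $\bigcap_{n=1}^\infty C_\phi^n(L^2(\mu))=\{0\}$. *)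

(* Defs.v *)
From HB Require Import structures.
From mathcomp Require Import all_boot all_order all_algebra.
From mathcomp Require Import all_classical all_reals all_analysis.
From mathcomp Require Import complex.

Set Implicit Arguments.
Unset Strict Implicit.
Unset Printing Implicit Defensive.

Import Order.TTheory GRing.Theory Num.Theory.

Local Open Scope classical_set_scope.
Local Open Scope ring_scope.

(* The space L^2(mu) of complex functions and composition operators on it.
   An element of L^2(mu) is represented by any function of its class modulo
   almost everywhere equality. *)
Section composition_operator.
Context d (T : measurableType d) (R : realType).
Variable mu : {measure set T -> \bar R}.

Definition L2norm (f : T -> R[i]) : \bar R :=
  'N[mu]_(2%:E)[EFin \o (fun x => Normc.normc (f x))]%E.

Definition L2 : set (T -> R[i]) :=
  [set f | [/\ measurable_fun [set: T] (fun x => complex.Re (f x)),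
               measurable_fun [set: T] (fun x => complex.Im (f x)) &
               (L2norm f < +oo)%E]].

Definition composition_op (phi : T -> T) (f : T -> R[i]) : T -> R[i] := f \o phi.

Definition everywhere_defined (phi : T -> T) : Prop :=
  forall f, L2 f -> L2 (composition_op phi f).

Definition bounded_composition_op (phi : T -> T) : Prop :=
  everywhere_defined phi /\
  exists M : R, forall f, L2 f ->
    (L2norm (composition_op phi f) <= M%:E * L2norm f)%E.

(* The functions whose class lies in the range of the n-th power. *)
Definition power_range (phi : T -> T) (n : nat) : set (T -> R[i]) :=
  [set g | L2 g /\
     exists2 f, L2 f & g = iter n (composition_op phi) f %[ae mu]].

Definition zero_class : set (T -> R[i]) :=
  [set g | L2 g /\ g = cst 0 %[ae mu]].

Definition analytic (phi : T -> T) : Prop :=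
  \bigcap_(n in [set n | (0 < n)%N]) power_range phi n = zero_class.

End composition_operator.

(* A value of eta in N or infinity is encoded as [Some n] or [None]; the set
   J_[1,eta] is shifted to {i | i < eta}. *)
Definition below (eta : option nat) (i : nat) : bool :=
  if eta is Some n then (i < n)%N else true.

Definition branch_index (eta : option nat) : Type := {i : nat | below eta i}.
HB.instance Definition _ eta := Countable.on (branch_index eta).

(* The vertex set X, for kappa = k.+1 and with indices counted from 0:
   [Circuit i] is x_{i+1} and [Branch i j] is x_{i+1,j+1}. *)
Inductive vertex (k : nat) (eta : option nat) : Type :=
  | Circuit of 'I_k.+1
  | Branch of branch_index eta & nat.
Arguments Circuit {k eta}.
Arguments Branch {k eta}.

Section vertex_structures.
Variables (k : nat) (eta : option nat).

Definition vertex_code (x : vertex k eta) : 'I_k.+1 + branch_index eta * nat :=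
  match x with Circuit i => inl i | Branch i j => inr (i, j) end.

Definition vertex_decode (s : 'I_k.+1 + branch_index eta * nat) : vertex k eta :=
  match s with inl i => Circuit i | inr (i, j) => Branch i j end.

Lemma vertex_codeK : cancel vertex_code vertex_decode.
Proof. by case. Qed.

HB.instance Definition _ := Countable.copy (vertex k eta) (can_type vertex_codeK).
HB.instance Definition _ := isPointed.Build (vertex k eta) (Circuit ord0).

HB.instance Definition _ := isMeasurable.Build default_measure_display
  (vertex k eta) (@discrete_measurable0 (vertex k eta))
  (@discrete_measurableC (vertex k eta)) (@discrete_measurableU (vertex k eta)).

(* [ord_pred] is the cyclic predecessor: it sends 0 (that is, x_1) to k
   (that is, x_kappa). *)
Definition circuit_map (x : vertex k eta) : vertex k eta :=
  match x with
  | Circuit i => Circuit (ord_pred i)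
  | Branch _ 0 => Circuit ord_max
  | Branch i j.+1 => Branch i j
  end.

End vertex_structures.

(* Main.v *)
Require Import Defs.
From HB Require Import structures.
From mathcomp Require Import all_boot all_order all_algebra.
From mathcomp Require Import all_classical all_reals all_analysis.
From mathcomp Require Import complex.

(** Every orbit of [phi := circuit_map] enters the circuit and then rotates
    along it.  Each vertex [x] therefore has a [phase], the vertex of the
    circuit whose orbit eventually coincides with that of [x]; it is the index
    of [x] modulo kappa, and the phase class of [r] consists of [Circuit r] and
    the vertices counted by the [r]-th series, so that its measure is finite
    exactly when this series converges ([measure_phase]).

    A function in the range of all powers of the composition operator is
    invariant under any identification made by an iterate of [phi], so it is
    constant on phase classes ([iter_eq_Circuit_phase]).  When all classes have
    infinite measure, square integrability makes each constant vanish
    ([L2_constant_on]).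

    Conversely, suppose that the class of [r] has finite measure.  Its
    indicator [g] is in L^2 ([L2_indic]).  A rotation by kappa steps is the
    identity on phases ([phase_iter_period]), so [g] is fixed by the kappa-th
    power of the operator [C]; hence g = C^(kappa n) g = C^n (C^((kappa - 1) n) g)
    is in the range of C^n for every n.  The inner factor lies in L^2 because
    [C] maps L^2 to itself, whatever the measures of the other classes.

    All points have positive measure, so almost everywhere means everywhere. *)

Set Implicit Arguments.
Unset Strict Implicit.
Unset Printing Implicit Defensive.

Import Order.TTheory GRing.Theory Num.Theory.

Local Open Scope classical_set_scope.
Local Open Scope ring_scope.

Section measures.
Context d (T : measurableType d) (R : realType) (mu : {measure set T -> \bar R}).

(** Countable additivity over an arbitrary countable index type, transported
    along [pickle] from the natural numbers. *)
Lemma measure_countable_bigcup (I : countType) (F : I -> set T) :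
  (forall i, measurable (F i)) -> trivIset setT F ->
  mu (\bigcup_i F i) = (\esum_(i in [set: I]) mu (F i))%E.
Proof.
move=> mF tF.
(* G n is empty when n is not the code of an index. *)
pose G n := \bigcup_(i in [set i | pickle i = n]) F i.
have GE i : G (pickle i) = F i.
  apply/seteqP; split=> [x [j /= /(pcan_inj pickleK) ->]//|x Fx].
  by exists i.
have mG n : range (@pickle I) n -> measurable (G n).
  by move=> [i _ <-]; rewrite GE.
have tG : trivIset (range (@pickle I)) G.
  move=> _ _ [i _ <-] [j _ <-]; rewrite !GE => ij.
  by rewrite (tF i j).
have -> : \bigcup_i F i = \bigcup_(n in range (@pickle I)) G n.
  apply/seteqP; split=> [x [i _ Fx]|x [_ [i _ <-]]].
    by exists (pickle i); [exists i | rewrite GE].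
  by rewrite GE => Fx; exists i.
rewrite measure_bigcup// nneseries_esum//.
have -> : [set x | x \in range (@pickle I)] = range (@pickle I).
  by apply/seteqP; split=> x /=; rewrite inE.
rewrite (reindex_esum [set: I] _ pickle).
  by apply: eq_esum => i _; rewrite GE.
split=> [i _|i j _ _ /(pcan_inj pickleK)//|_ [i _ <-]]; [by exists i|by exists i].
Qed.

Lemma L2norm_lty (f : T -> R[i]) :
  (L2norm mu f < +oo)%E <->
  (\int[mu]_x (Normc.normc (f x) ^+ 2)%:E < +oo)%E.
Proof.
have -> : (\int[mu]_x (Normc.normc (f x) ^+ 2)%:E = L2norm mu f `^ 2)%E.
  rewrite /L2norm powR_Lnorm//; apply: eq_integral => x _ /=.
  by rewrite powR_mulrn// real_normK// num_real.
by split=> [/poweR_lty|/lty_poweRy]; apply.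
Qed.

Lemma everywhere_of_ae (P : set T) :
  (forall x : T, measurable [set x]) -> (forall x, (0 < mu [set x])%E) ->
  (\forall x \ae mu, P x) -> forall x, P x.
Proof.
move=> m1 mu_gt0 [N [mN N0 NP] x]; apply: contrapT => nPx.
have := mu_gt0 x; rewrite ltNge => /negP; apply; rewrite -N0.
by apply: le_measure; rewrite ?inE// => _ ->; apply: NP.
Qed.

End measures.

Lemma iter_composition_op d (T : measurableType d) (R : realType)
  (phi : T -> T) n (f : T -> R[i]) x :
  iter n (composition_op phi) f x = f (iter n phi x).
Proof. by elim: n x => // n IH x; rewrite [in RHS]iterSr -IH. Qed.

Section circuit.
Variables (k : nat) (eta : option nat).
Let phi := @circuit_map k eta.

(** The circuit vertex in step with [x]: [Branch i j] and [Circuit (j %% k.+1)]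
    both reach the last circuit vertex after j + 1 steps. *)
Definition phase (x : vertex k eta) : 'I_k.+1 :=
  match x with Circuit i => i | Branch _ j => Ordinal (ltn_pmod j (ltn0Sn k)) end.

Lemma phase_circuit_map x : phase (phi x) = ord_pred (phase x).
Proof.
apply: val_inj; case: x => [//|i [|j]] /=.
  by rewrite modn_small.
by rewrite addnS /= modnDml addSnnS modnDr.
Qed.

Lemma phase_iter n x : phase (iter n phi x) = iter n (@ord_pred _) (phase x).
Proof. by elim: n => //= n IH; rewrite phase_circuit_map IH. Qed.

Lemma iter_Circuit n c : iter n phi (Circuit c) = Circuit (iter n (@ord_pred _) c).
Proof. by elim: n => //= n ->. Qed.

Lemma iter_Branch i j : iter j.+1 phi (Branch i j) = Circuit ord_max.
Proof. by elim: j => // j IH; rewrite iterSr. Qed.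

(** A vertex and its phase merge under some iterate of the map.  For
    [Branch i j] this happens at step j + 1, when the former is on the circuit:
    a circuit vertex is its own phase, and [phase] commutes with the dynamics. *)
Lemma iter_eq_Circuit_phase x :
  exists2 n, (0 < n)%N & iter n phi x = iter n phi (Circuit (phase x)).
Proof.
case: x => [c|i j]; first by exists 1%N.
exists j.+1 => //; rewrite iter_Circuit -phase_iter iter_Branch//.
Qed.

(** One step back on a cycle of length k + 1 is k steps forward, which avoids
    subtraction. *)
Lemma iter_ord_pred_val n (c : 'I_k.+1) :
  iter n (@ord_pred _) c = ((c + n * k) %% k.+1)%N :> nat.
Proof.
elim: n => [|n IH] /=; first by rewrite addn0 modn_small.
by rewrite IH addnS /= modnDml -addnA -mulSnr.
Qed.

Lemma phase_iter_period n x : phase (iter (n * k.+1) phi x) = phase x.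
Proof.
rewrite phase_iter; apply: val_inj => /=.
by rewrite iter_ord_pred_val mulnAC addnC modnMDl modn_small.
Qed.

Lemma preimage_phase r :
  phase @^-1` [set r] = [set Circuit r] `|`
    \bigcup_i \bigcup_l [set Branch i (l * k.+1 + r)%N].
Proof.
apply/seteqP; split=> [[c|i j] /= <-|x [->//|[i _ [l _ ->]]]].
- by left.
- by right; exists i => //; exists (j %/ k.+1)%N; rewrite //= -divn_eq.
- by apply: val_inj; rewrite /= modnMDl modn_small.
Qed.

Section spaces.
Variables (R : realType) (mu : {measure set (vertex k eta) -> \bar R}).

Lemma vertex_measurable_fun d (T : measurableType d) (f : vertex k eta -> T) :
  measurable_fun setT f.
Proof. by []. Qed.

Lemma measure_phase r :
  mu (phase @^-1` [set r]) = (mu [set Circuit r] +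
    \esum_(i in [set: branch_index eta])
        \sum_(0 <= l <oo) mu [set Branch i (l * k.+1 + r)%N])%E.
Proof.
rewrite preimage_phase measureU//; last first.
  by apply/seteqP; split=> // x [-> [i _ [l _]]].
congr (_ + _)%E; apply: etrans (measure_countable_bigcup mu _ _) _ => //.
  by move=> i j _ _ [x [[l _ ->] [m _ []]]].
apply: eq_esum => i _ /=.
rewrite measure_countable_bigcup ?nneseries_esumT//.
move=> l m _ _ [x [-> [] /eqP]].
by rewrite eqn_add2r eqn_pmul2r// => /eqP.
Qed.

Lemma L2_indic (A : set (vertex k eta)) : (mu A < +oo)%E ->
  L2 mu (fun x => (\1_A x)%:C%C).
Proof.
move=> Afin; split; [exact: vertex_measurable_fun..|].
apply/L2norm_lty; suff -> : (\int[mu]_x (Normc.normc (\1_A x)%:C%C ^+ 2)%:E)%E = mu A by [].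
rewrite -[X in _ = mu X](setIT A) -integral_indic//.
apply: eq_integral => x _; rewrite /= expr0n addr0 sqrtr_sqr indicE.
by case: (x \in A); rewrite ?normr1 ?normr0 ?expr1n ?expr0n.
Qed.

(** The integral of |f|^2 is at least |c|^2 times the measure of A. *)
Lemma L2_constant_on (A : set (vertex k eta)) (f : vertex k eta -> R[i]) c :
  L2 mu f -> (forall x, A x -> f x = c) -> mu A = +oo%E -> c = 0.
Proof.
move=> [_ _ /L2norm_lty ffin] fA muA; apply: contrapT => c0.
have c2 : 0 < Normc.normc c ^+ 2.
  rewrite lt_neqAle sqr_ge0 andbT eq_sym expf_eq0 /=.
  by apply/eqP => /Normc.eq0_normc.
suff : (\int[mu]_(x in A) (Normc.normc (f x) ^+ 2)%:E = +oo)%E.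
  move=> Ioo; move: ffin; rewrite ltNge => /negP; apply.
  rewrite -Ioo; apply: ge0_subset_integral => //.
  by move=> x _; rewrite lee_fin sqr_ge0.
rewrite (eq_integral (cst (Normc.normc c ^+ 2)%:E)).
  by rewrite integral_cst// muA gt0_muley// lte_fin.
by move=> x; rewrite inE => /fA ->.
Qed.

End spaces.
End circuit.
Arguments phase {k eta}.

(* kappa = k.+1, and r stands for the residue r + 1 of {1, ..., kappa}, so that
   Branch i (l * k.+1 + r) is x_{i+1, l * kappa + (r + 1)}. *)
Theorem proposition4p2 (R : realType) (k : nat) (eta : option nat)
    (eta_gt0 : eta <> Some 0%N)
    (mu : {measure set (vertex k eta) -> \bar R})
    (mu_point : forall x : vertex k eta, (0 < mu [set x] < +oo)%E)
    (bdd : bounded_composition_op mu (@circuit_map k eta)) :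
  analytic mu (@circuit_map k eta) <->
  (forall r : 'I_k.+1,
     (\esum_(i in [set: branch_index eta])
        \sum_(0 <= l <oo) mu [set Branch i (l * k.+1 + r)%N] = +oo)%E).
Proof.
pose phi := @circuit_map k eta.
have ae_all (P : set (vertex k eta)) : (\forall x \ae mu, P x) -> forall x, P x.
  by apply: everywhere_of_ae => // x; case/andP: (mu_point x).
split=> [ana r|div].
  apply/eqP; rewrite -[_ == _]negbK -ltey; apply/negP => fin.
  pose A := phase @^-1` [set r] : set (vertex k eta).
  pose g x : R[i] := (\1_A x)%:C%C.
  have L2g : L2 mu g.
    apply: L2_indic; rewrite measure_phase lte_add_pinfty//.
    by case/andP: (mu_point (Circuit r)).
  have L2_iter n : L2 mu (iter n (composition_op phi) g).
    by elim: n => //= n; apply: bdd.1.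
  have : zero_class mu g.
    rewrite -ana => n _; split=> //.
    (* kappa - 1 = k, so n * k + n = kappa * n steps in all *)
    exists (iter (n * k) (composition_op phi) g) => //.
    apply: aeW => x _; rewrite -iterD -mulnS iter_composition_op /g !indicE.
    congr ((_ _)%:R%:C%C).
    by apply/idP/idP; rewrite !inE /A /= phase_iter_period.
  case=> _ /ae_all/(_ (Circuit r) I); rewrite /g indicE mem_set//.
  by case=> /eqP; rewrite oner_eq0.
apply/seteqP; split=> [g gran|g [L2g /ae_all g0] n _].
  have [L2g _] := gran 1%N isT.
  have g_phase x : g x = g (Circuit (phase x)).
    have [n n0 nx] := iter_eq_Circuit_phase x.
    have [_ [f _ /ae_all gf]] := gran n n0.
    by rewrite !gf// !iter_composition_op -/phi nx.
  split=> //; apply: aeW => x _; rewrite g_phase /=.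
  apply: (L2_constant_on (A := phase @^-1` [set phase x]) L2g).
    by move=> y /= <-.
  by rewrite measure_phase div addey// -ltNye (lt_le_trans _ (measure_ge0 _ _)).
split=> //; exists g => //.
by apply: aeW => x _; rewrite iter_composition_op !g0.
Qed.
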